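(* Let $m,n$ be positive integers, let $\mathcal{A}$ and $\mathcal{B}$ be real $m$-th order $n$-dimensional tensors, and let $K\subset\mathbb{R}^n$ be a closed convex cone with $K\cap(-K)=\{0\}$ that is equipped with a convex compact basis $S$. Assume that $\mathcal{B}x^m\neq 0$ for every $x\in S$. Then there exist a scalar $\bar\lambda\in\mathbb{R}$ and a nonzero vector $\bar x\in\mathbb{R}^n$ such that $$\bar x\in K,\qquad \bar\lambda\,\mathcal{B}\bar x^{m-1}-\mathcal{A}\bar x^{m-1}\in K^*,\qquad \langle \bar x,\ \bar\lambda\,\mathcal{B}\bar x^{m-1}-\mathcal{A}\bar x^{m-1}\rangle=0.$$
   Context: A real $m$-th order $n$-dimensional tensor is an array $\mathcal{A}=(a_{i_1\cdots i_m})$ with $a_{i_1\cdots i_m}\in\mathbb{R}$ for $1\le i_1,\ldots,i_m\le n$. For $x\in\mathbb{R}^n$, $\mathcal{A}x^{m-1}\in\mathbb{R}^n$ is the vector with $(\mathcal{A}x^{m-1})_i=\sum_{i_2,\ldots,i_m=1}^n a_{ii_2\cdots i_m}x_{i_2}\cdots x_{i_m}$, and $\mathcal{A}x^m=\sum_{i_1,\ldots,i_m=1}^n a_{i_1\cdots i_m}x_{i_1}\cdots x_{i_m}$. The positive dual cone of $K$ is $K^*=\{w\in\mathbb{R}^n:\langle w,k\rangle\ge 0\ \ \forall k\in K\}$. A nonempty set $S\subset\mathbb{R}^n$ is a basis of the cone $K$ if $K=\{ts: s\in S,\ t\in\mathbb{R}_+\}$, $0\notin S$, and for each $k\in K\setminus\{0\}$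 there exist unique $s\in S$ and $t\in\mathbb{R}_+$ such that $k=ts$. *)

(* Defs.v *)
From HB Require Import structures.
From mathcomp Require Import all_boot all_order all_algebra.
From mathcomp Require Import all_classical all_reals all_analysis.

Set Implicit Arguments.
Unset Strict Implicit.
Unset Printing Implicit Defensive.

Import Order.TTheory GRing.Theory Num.Theory.
Import numFieldNormedType.Exports.

Local Open Scope classical_set_scope.
Local Open Scope ring_scope.

(* [A j] is the entry a_{i_1 ... i_m} for the multi-index j = (i_1, ..., i_m). *)
Definition tensor (R : realType) (m n : nat) : Type := m.-tuple 'I_n -> R.

(* A x^m *)
Definition tform (R : realType) (m n : nat) (A : tensor R m n)
    (x : 'rV[R]_n) : R :=
  \sum_(j : m.-tuple 'I_n) A j * \prod_(k < m) x 0 (tnth j k).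

(* A x^(m-1) for a tensor A of order m = p + 1: the first index is free and
   the remaining p ones are contracted with x. *)
Definition tapply (R : realType) (p n : nat) (A : tensor R p.+1 n)
    (x : 'rV[R]_n) : 'rV[R]_n :=
  \row_(i < n) \sum_(j : p.-tuple 'I_n)
     A [tuple of i :: j] * \prod_(k < p) x 0 (tnth j k).

Definition dotv (R : realType) (n : nat) (x y : 'rV[R]_n) : R :=
  \sum_(i < n) x 0 i * y 0 i.

(* Nonemptiness is not included. *)
Definition is_cone (R : realType) (n : nat) (K : set 'rV[R]_n) : Prop :=
  forall (t : R) (x : 'rV[R]_n), 0 <= t -> K x -> K (t *: x).

Definition pos_dual (R : realType) (n : nat) (K : set 'rV[R]_n) :
    set 'rV[R]_n :=
  [set w | forall k, K k -> 0 <= dotv w k].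

Definition is_cone_basis (R : realType) (n : nat) (S K : set 'rV[R]_n) : Prop :=
  [/\ S !=set0,
      K = [set k | exists s t, [/\ S s, 0 <= t & k = t *: s]],
      ~ S 0 &
      forall k, K k -> k != 0 ->
        exists! st : 'rV[R]_n * R,
          [/\ S st.1, 0 <= st.2 & k = st.2 *: st.1]].

(* Main.v *)
(** Put lambda(x) = A x^m / B x^m on S.  A point x of S such that
    [lambda(x) B x^(m-1) - A x^(m-1)] is nonnegative on S is a solution:
    nonnegativity extends from S to K = R_+ S, and orthogonality to x is the
    choice of lambda(x).  Multiplying by (B x^m)^2 gives the polynomial form
    [g x y], linear in y, with [g x x = 0], and the point x solves the
    variational inequality [g x y >= 0] for all y in S.  By compactness it is
    enough to solve it approximately for finitely many test points y_i; this is
    done on the simplex spanned by the y_i, whose grid points are labelled by an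
    i minimising [g x y_i].  Scarf's combinatorial lemma provides a small set of
    grid points carrying every label i whose barycentric coordinate is not
    small, so all these [g x y_i] are nearly minimal, while their barycentric
    mean [g x x] is 0. *)
From mathcomp Require Import all_boot.

Set Implicit Arguments.
Unset Strict Implicit.
Unset Printing Implicit Defensive.

(** * Dominant sets for a family of injective rankings, and their exchange property *)

Section Dominance.
Variables (W I : finType) (rk : I -> W -> nat).
Hypothesis rk_inj : forall i, injective (rk i).

(* A set Z of [#|I|] elements plays the role of a maximal simplex, and a set of
   [#|I|.-1] elements that of a facet. *)
Definition dominant (Z : {set W}) :=
  [forall w, [exists i, [forall z in Z, rk i w <= rk i z]]].

Lemma dominantP (Z : {set W}) :
  reflect (forall w, exists i, forall z, z \in Z -> rk i w <= rk i z)
          (dominant Z).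
Proof.
apply: (iffP forallP) => H w; have := H w.
  by case/existsP=> i /forall_inP Hi; exists i.
by case=> i Hi; apply/existsP; exists i; apply/forall_inP.
Qed.

Lemma dominantS (Y Z : {set W}) : Y \subset Z -> dominant Z -> dominant Y.
Proof.
move=> /subsetP YZ /dominantP dZ; apply/dominantP => w.
by have [i Hi] := dZ w; exists i => z /YZ; apply: Hi.
Qed.

Definition is_min (Z : {set W}) k z :=
  z \in Z /\ forall z', z' \in Z -> rk k z <= rk k z'.

Lemma is_min_uniq (Z : {set W}) k z z' :
  is_min Z k z -> is_min Z k z' -> z = z'.
Proof.
move=> [zZ mz] [z'Z mz']; apply: (@rk_inj k); apply/eqP.
by rewrite eqn_leq mz ?mz'.
Qed.

(** Dominance at a point of [Z] itself makes that point the minimum of [Z] for some index. This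
    gives an injection from [Z] to [I], bijective by cardinality, so no point is the minimum for two
    indices. *)
Lemma dominant_min_inj (Z : {set W}) k k' z : dominant Z -> #|Z| = #|I| ->
  is_min Z k z -> is_min Z k' z -> k = k'.
Proof.
move=> /dominantP dZ cZ.
have [c Hc] : exists c : W -> I, forall w z, z \in Z -> rk (c w) w <= rk (c w) z.
  exact: (@fin_all_exists _ (fun=> I)
    (fun w i => forall z, z \in Z -> rk i w <= rk i z)).
have c_min x : x \in Z -> is_min Z (c x) x by move=> xZ; split => //; apply: Hc.
have c_inj : {in Z &, injective c}.
  move=> x y xZ yZ cxy; apply: (is_min_uniq (c_min x xZ)).
  by rewrite cxy; apply: c_min.
have c_surj i : i \in c @: Z.
  suff -> : c @: Z = setT by [].
  by apply/eqP; rewrite eqEcard subsetT cardsT card_in_imset // cZ leqnn.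
suff minc i x : is_min Z i x -> i = c x by move=> /minc -> /minc.
move=> mx; have /imsetP[y yZ iy] := c_surj i.
by rewrite iy; congr c; apply: is_min_uniq mx; rewrite iy; apply: c_min.
Qed.

(* The map sending i to the rk_i-minimum of Z is onto Z and identifies exactly
   two indices i and j; the extensions of Z are obtained by adding, for e = i
   or e = j, the rk_e-largest element that lies above Z in all other orders. *)
Lemma card_dominant_extensions (Z : {set W}) :
    dominant Z -> #|Z|.+1 = #|I| -> Z != set0 ->
    (forall i, exists w, forall k, k != i ->
       exists2 z, z \in Z & rk k z < rk k w) ->
  #|[set w | (w \notin Z) && dominant (w |: Z)]| = 2.
Proof.
move=> dZ cZ /set0Pn[z0 z0Z] above.
pose m i := [arg min_(z < z0 in Z) rk i z].
have mP i : is_min Z i (m i) by rewrite /m; case: arg_minnP.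
have mZ i : m i \in Z by case: (mP i).
have mle i z : z \in Z -> rk i (m i) <= rk i z by case: (mP i) => _; apply.
have dZP := dominantP _ dZ.
have m_surj z : z \in Z -> exists i, z = m i.
  by move=> zZ; have [i Hi] := dZP z; exists i; apply: is_min_uniq (mP i).
have [i [j [ij mij]]] : exists i j, i != j /\ m i = m j.
  case: (boolP (injectiveb m)) => [/injectiveP m_inj|]; last first.
    by case/injectivePn=> i [j ij mij]; exists i, j.
  have : #|[set m i | i : I]| <= #|Z|.
    by apply/subset_leq_card/subsetP=> _ /imsetP[i _ ->].
  by rewrite card_imset // -cZ ltnn.
have m_surjD e : e \in [set i; j] -> m @: [set~ e] = Z.
  move=> eij; apply/setP => z; apply/imsetP/idP => [[k _ ->] //|].
  move=> /m_surj[k ->]; case: (eqVneq k e) => [->|ke]; last first.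
    by exists k; rewrite ?inE.
  have [f fe <-] : exists2 f, f != e & m f = m e.
    move: eij; rewrite !inE => /orP[]/eqP->; first by exists j; rewrite 1?eq_sym.
    by exists i.
  by exists f; rewrite ?inE.
have m_injD e : e \in [set i; j] -> {in [set~ e] &, injective m}.
  by move=> eij; apply/imset_injP; rewrite m_surjD // cardsC1 -cZ eqxx.
pose M e w := [forall k, (k != e) ==> (rk k (m k) < rk k w)].
have MP e w : reflect (forall k, k != e -> rk k (m k) < rk k w) (M e w).
  by apply: (iffP forallP) => H k; have /implyP := H k.
have Mex e : exists w, M e w.
  have [w Hw] := above e; exists w; apply/MP => k /Hw[z zZ].
  by apply: leq_ltn_trans; apply: mle.
have [t Ht] : exists t : I -> W, forall e, M e (t e) /\
    forall w, M e w -> rk e w <= rk e (t e).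
  apply: (@fin_all_exists _ (fun=> W) (fun e w' => M e w' /\
    forall w, M e w -> rk e w <= rk e w')) => e.
  have [w0 Mw0] := Mex e.
  by exists [arg max_(w > w0 | M e w) rk e w]; case: arg_maxnP.
have tle e : rk e (t e) <= rk e (m e).
  have [k Hk] := dZP (t e); case: (eqVneq k e) Hk => [->|ke] Hk; first exact: Hk.
  have [/MP/(_ k ke) + _] := Ht e.
  by rewrite ltnNge Hk.
have t_new e : e \in [set i; j] -> t e \notin Z.
  move=> eij; apply/negP; rewrite -{1}(m_surjD e eij) => /imsetP[k ke tk].
  have [/MP/(_ k) + _] := Ht e.
  by rewrite tk ltnn => H; move: ke; rewrite !inE => /H.
have t_dom e : dominant (t e |: Z).
  apply/dominantP => w; have [/MP Mt maxt] := Ht e.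
  case: (boolP (M e w)) => [Mw|]; last first.
    rewrite negb_forall => /existsP[k]; rewrite negb_imply -leqNgt => /andP[ke wk].
    exists k => z /setU1P[->|zZ]; first by rewrite (leq_trans wk) // ltnW // Mt.
    by rewrite (leq_trans wk) // mle.
  exists e => z /setU1P[->|zZ]; first exact: maxt.
  by rewrite (leq_trans (maxt _ Mw)) // (leq_trans (tle e)) // mle.
(* A common value would lie strictly above the minimum of [Z] in every order, against the dominance
   of [Z]. *)
have tij : t i != t j.
  apply/eqP => tt; have [k Hk] := dZP (t i).
  have [/MP Mi _] := Ht i; have [/MP Mj _] := Ht j.
  have := Hk _ (mZ k); rewrite leqNgt; case: (eqVneq k i) => [ki|/Mi-> //].
  by rewrite tt Mj // ki.
suff -> : [set w | (w \notin Z) && dominant (w |: Z)] = [set t i; t j].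
  by rewrite cards2 tij.
apply/setP => w; rewrite !inE; apply/andP/orP => [[wZ dw]|]; last first.
  by case=> /eqP->; rewrite t_new ?t_dom ?inE ?eqxx ?orbT.
have cw : #|w |: Z| = #|I| by rewrite cardsU1 wZ add1n.
have dwP := dominantP _ dw.
(* Dominance at [w] makes [w] the minimum of [w |: Z] for [k], hence for no other index: [w] is a
   candidate for [t k]. *)
have [k Hk] := dwP w.
have w_min f : (forall z, z \in Z -> rk f w <= rk f z) -> is_min (w |: Z) f w.
  by move=> H; split=> [|z /setU1P[->|/H]//]; rewrite setU11.
have mk f : f != k -> rk f (m f) < rk f w.
  rewrite ltnNge => fk; apply: contraNN fk => wf; apply/eqP.
  apply: (dominant_min_inj (z := w) dw cw); last by split=> //; rewrite setU11.
  by apply: w_min => z zZ; apply: leq_trans wf (mle _ _ zZ).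
have Mw : M k w by apply/MP.
(* Otherwise the point [m i = m j] would still be the minimum of [w |: Z] for both [i] and [j]. *)
have kij : k \in [set i; j].
  rewrite !inE; apply: contraNT ij; rewrite negb_or => /andP[ki kj].
  have mmin f : k != f -> is_min (w |: Z) f (m f).
    move=> kf; split=> [|z /setU1P[->|]]; first by rewrite setU1r.
      by rewrite ltnW // mk // eq_sym.
    exact: mle.
  apply/eqP/(dominant_min_inj (z := m i) dw cw); first exact: mmin.
  by rewrite mij; apply: mmin.
have -> : w = t k.
  have [/MP Mt maxt] := Ht k.
  apply: (@rk_inj k); apply/eqP; rewrite eqn_leq maxt //=.
  have [f Hf] := dwP (t k); case: (eqVneq f k) Hf => [->|fk] Hf.
    by apply: Hf; rewrite setU11.
  by have := Hf (m f); rewrite setU1r // leqNgt Mt // => /(_ isT).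
by move: kij; rewrite !inE => /orP[]/eqP->; rewrite eqxx; [left|right].
Qed.

End Dominance.

(** * Parity of facets carrying every label but one *)

(** The count is 0 or 2: if removing [z1] leaves exactly the labels other than [i0], each once, then
    the label of [z1] is repeated at a single other point [z2], and only [z1] or [z2] can be
    removed. *)
Lemma card_rainbow_facets (W I : finType) (lab : W -> I) (i0 : I)
    (Z : {set W}) : #|Z| = #|I| -> lab @: Z != setT ->
  ~~ odd #|[set z in Z | lab @: (Z :\ z) == [set~ i0]]|.
Proof.
move=> cZ nfull.
case: (set_0Vmem [set z in Z | lab @: (Z :\ z) == [set~ i0]]) => [->|[z1]].
  by rewrite cards0.
rewrite inE => /andP[z1Z /eqP lab1].
have inj z : z \in Z -> lab @: (Z :\ z) = [set~ i0] -> {in Z :\ z &, injective lab}.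
  by move=> zZ lz; apply/imset_injP; rewrite lz cardsC1 -cZ (cardsD1 z) zZ add1n.
have labz1 : lab z1 \in lab @: (Z :\ z1).
  rewrite lab1 !inE; apply: contra nfull => /eqP l1.
  by rewrite -(setD1K z1Z) imsetU1 l1 lab1 setUCr.
have /imsetP[z2 z2Z l12] := labz1.
have z21 : z2 != z1 by move: z2Z; rewrite !inE => /andP[].
have {}z2Z : z2 \in Z by move: z2Z; rewrite !inE => /andP[].
suff -> : [set z in Z | lab @: (Z :\ z) == [set~ i0]] = [set z1; z2].
  by rewrite cards2 eq_sym z21.
apply/setP => z; rewrite !inE; apply/andP/orP => [[zZ /eqP lz]|]; last first.
  case=> /eqP->; first by rewrite z1Z lab1 eqxx.
  split=> //; rewrite -lab1; apply/eqP/setP => k.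
  apply/imsetP/imsetP => -[x]; rewrite !inE => /andP[xn xZ ->].
    case: (eqVneq x z1) => [->|xz1]; first by exists z2; rewrite ?inE ?z21.
    by exists x; rewrite ?inE ?xz1.
  case: (eqVneq x z2) => [->|xz2]; first by exists z1; rewrite ?inE 1?eq_sym ?z21 ?z1Z.
  by exists x; rewrite ?inE ?xz2.
case: (eqVneq z z1) => [|zz1]; first by left.
case: (eqVneq z z2) => [|zz2]; first by right.
have := inj z zZ lz z1 z2; rewrite !inE ![_ == z]eq_sym zz1 zz2 z1Z z2Z => /(_ isT isT l12) e.
by rewrite e eqxx in z21.
Qed.

Lemma even_sum (J : finType) (P : pred J) (F : J -> nat) :
  (forall j, P j -> ~~ odd (F j)) -> ~~ odd (\sum_(j | P j) F j).
Proof.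
move=> evenF; elim/big_ind: _ => // a b; rewrite oddD.
by move=> /negPf-> /negPf->.
Qed.

(** Incidences between doors and rooms are counted twice. Each door lies in two rooms, except [Z0],
    which lies in an odd number, so the total is odd; a room missing some label contributes an even
    number, so some room carries all labels. *)
Lemma odd_boundary_doors (W I : finType) (rk : I -> W -> nat) (lab : W -> I)
    (i0 : I) (Z0 : {set W}) : (forall i, injective (rk i)) ->
  dominant rk Z0 -> lab @: Z0 = [set~ i0] -> #|Z0|.+1 = #|I| ->
  odd #|[set w | (w \notin Z0) && dominant rk (w |: Z0)]| ->
  (forall Z, dominant rk Z -> lab @: Z = [set~ i0] -> #|Z|.+1 = #|I| ->
     Z != Z0 ->
     Z != set0 /\ forall i, exists w, forall k, k != i ->
       exists2 z, z \in Z & rk k z < rk k w) ->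
  exists Z, [/\ dominant rk Z, #|Z| = #|I| & lab @: Z = setT].
Proof.
move=> rk_inj dZ0 lZ0 cZ0 odd0 inner.
pose A (Z : {set W}) := [set w | (w \notin Z) && dominant rk (w |: Z)].
pose B (Z : {set W}) := [set z in Z | lab @: (Z :\ z) == [set~ i0]].
pose door (Z : {set W}) := [&& dominant rk Z, lab @: Z == [set~ i0] & #|Z|.+1 == #|I|].
pose room (Z : {set W}) := dominant rk Z && (#|Z| == #|I|).
have double : \sum_(Z | door Z) #|A Z| = \sum_(Z | room Z) #|B Z|.
  under eq_bigr do rewrite -sum1_card.
  under [RHS]eq_bigr do rewrite -sum1_card.
  rewrite (exchange_big_dep predT) //= [RHS](exchange_big_dep predT) //=.
  apply: eq_bigr => w _.
  (* For a fixed [w], adding [w] to a door and removing [w] from a room are inverse operations. *)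
  rewrite (reindex_onto (fun Z => Z :\ w) (fun Z => w |: Z)) /=; last first.
    by move=> Z; rewrite inE => /andP[_ /andP[wZ _]]; rewrite setU1K.
  apply: eq_bigl => Z; rewrite /door /room !inE eqxx /=.
  apply/andP/andP => [[/andP[/and3P[dZ lZ cZ] dw] /eqP Zw]|].
    have wZ : w \in Z by rewrite -Zw setU11.
    rewrite Zw in dw; rewrite dw wZ lZ; split=> //.
    by rewrite -(eqP cZ) [in #|Z|](cardsD1 w) wZ add1n eqxx.
  move=> [/andP[dZ /eqP cZ] /andP[wZ lZ]]; rewrite setD1K // lZ dZ eqxx.
  rewrite (dominantS _ dZ) ?subD1set //= -cZ [in #|Z|](cardsD1 w) wZ add1n.
  by rewrite eqxx.
have odd_doors : odd (\sum_(Z | door Z) #|A Z|).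
  rewrite (bigD1 Z0) /=; last by rewrite /door dZ0 lZ0 cZ0 !eqxx.
  rewrite oddD odd0 addTb; apply: even_sum => Z.
  move=> /andP[/and3P[dZ /eqP lZ /eqP cZ] ZZ0].
  have [Zn0 above] := inner Z dZ lZ cZ ZZ0.
  by rewrite /A card_dominant_extensions.
case: (boolP [exists Z, room Z && (lab @: Z == setT)]) => [|none].
  by case/existsP=> Z /andP[/andP[dZ /eqP cZ] /eqP lZ]; exists Z.
have : ~~ odd (\sum_(Z | room Z) #|B Z|).
  apply: even_sum => Z rZ; apply: card_rainbow_facets.
    by case/andP: rZ => _ /eqP.
  by apply: contraNneq none => lZ; apply/existsP; exists Z; rewrite rZ lZ eqxx.
by rewrite -double odd_doors.
Qed.

(** * Scarf's combinatorial lemma *)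

Section Scarf.
Variables (T I : finType) (r : I -> T -> nat) (l : T -> I).
Hypothesis r_inj : forall i, injective (r i).

Let bound := \max_(p : I * T) r p.1 p.2.

(* The slack element [inr j] is labelled j, is the least element for the order j
   and lies above T for the other orders; a set of T + I containing [inr j]
   thus does not use the order j, and the pair (C, D) of [scarf] is encoded by
   C and the slack elements of the complement of D. *)
Let slack_rank (i : I) (w : T + I) : nat :=
  match w with
  | inl t => (r i t).+1
  | inr j => if j == i then 0 else (bound + enum_rank j).+2
  end.

Let slack_label (w : T + I) : I := match w with inl t => l t | inr j => j end.

Let r_bound i t : r i t <= bound.
Proof. exact: (@leq_bigmax _ (fun p : I * T => r p.1 p.2) (i, t)). Qed.

(** The ranges are disjoint: 0 for the slack element [i], 1 to [bound + 1] for [T], and at least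
    [bound + 2] for the other slack elements, which [enum_rank] separates. *)
Let slack_rank_inj i : injective (slack_rank i).
Proof.
have lt t j : (r i t).+1 <> (bound + enum_rank j).+2.
  by move=> [e]; have := r_bound i t; rewrite e ltnNge leq_addr.
move=> [t|j] [t'|j'] //=.
- by move=> [/r_inj->].
- by case: ifP => // _ /lt.
- by case: ifP => // _ /esym/lt.
- case: ifP => [/eqP->|]; case: ifP => [/eqP->|] //.
  by move=> _ _ [/addnI/ord_inj/enum_rank_inj->].
Qed.

Lemma scarf (t0 : T) : exists (C : {set T}) (D : {set I}),
  [/\ D != set0, l @: C = D &
      forall t, exists2 i, i \in D & forall c, c \in C -> r i t <= r i c].
Proof.
pose i0 := l t0.
pose Z0 : {set T + I} := [set inr j | j in [set~ i0]].
have inrZ0 j : (inr j \in Z0) = (j != i0).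
  by rewrite mem_imset ?inE // => ? ? [].
have inlZ0 t : (inl t \in Z0) = false by apply/imsetP => -[].
have labZ0 : slack_label @: Z0 = [set~ i0].
  by rewrite -imset_comp; apply: imset_id.
have cZ0 : #|Z0|.+1 = #|I|.
  by rewrite card_imset ?cardsC1 => [|? ? [] //]; rewrite prednK //; apply/card_gt0P; exists i0.
have slack_above i k t : k != i -> slack_rank k (inl t) < slack_rank k (inr i).
  by move=> ki; rewrite /= eq_sym (negPf ki) !ltnS (leq_trans (r_bound k t)) ?leq_addr.
have not_below (Z : {set T + I}) i t :
    (forall z, z \in Z -> slack_rank i (inl t) <= slack_rank i z) -> inr i \notin Z.
  by move=> H; apply/negP => /H /=; rewrite eqxx.
have [Z [dZ cZ lZ]] : exists Z : {set T + I}, [/\ dominant slack_rank Z,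
    #|Z| = #|I| & slack_label @: Z = setT].
  apply: (odd_boundary_doors (i0 := i0) (Z0 := Z0)) => //.
  - apply/dominantP => -[t|j]; last by exists j => z _ /=; rewrite eqxx.
    exists i0 => z /imsetP[j]; rewrite !inE => ji0 ->.
    by rewrite ltnW // slack_above // eq_sym.
  (* [Z0] lies in exactly one room: its only extension is by the element of [T] that is largest for
     [i0]. *)
  - pose tm := [arg max_(t > t0) r i0 t].
    have tmP t : r i0 t <= r i0 tm by rewrite /tm; case: arg_maxnP => // ? _; apply.
    rewrite (_ : [set w | _] = [set inl tm]) ?cards1 //.
    apply/setP => w; rewrite !inE; apply/andP/eqP => [[wZ0 /dominantP dw]|->].
      have [i Hi] := dw (inl tm).
      have := not_below _ _ _ Hi; rewrite !inE inrZ0 negb_or negbK.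
      case/andP=> iw /eqP ii0; subst i.
      case: w {dw} wZ0 iw Hi => [t _ _|j]; last first.
        by rewrite inrZ0 negbK => /eqP->; rewrite eqxx.
      move=> /(_ _ (setU11 _ _)) /= tmt; congr inl; apply: (@r_inj i0).
      by apply/eqP; rewrite eqn_leq tmP.
    rewrite inlZ0; split=> //; apply/dominantP => -[t|j].
      exists i0 => z /setU1P[->|/imsetP[j]]; first by rewrite /= ltnS.
      by rewrite !inE => ji0 ->; rewrite ltnW // slack_above // eq_sym.
    by exists j => z _ /=; rewrite eqxx.
  (* A door made of slack elements only would be [Z0], by its labels and cardinality. Any other door
     contains some [inl t], above which [inr i] lies in all orders except [i]. *)
  - move=> Z dZ lZ cZ ZZ0.
    have [t tZ] : exists t, inl t \in Z.
      apply/existsP; apply: contraNT ZZ0; rewrite negb_exists => /forallP noT.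
      rewrite eqEcard -ltnS cZ cZ0 leqnn andbT; apply/subsetP => -[t|j] wZ.
        by have := noT t; rewrite wZ.
      by rewrite inrZ0; have := imset_f slack_label wZ; rewrite lZ !inE.
    split=> [|i]; first by apply/set0Pn; exists (inl t).
    by exists (inr i) => k ki; exists (inl t) => //; apply: slack_above.
have lab_inj : {in Z &, injective slack_label}.
  by apply/imset_injP; rewrite lZ cZ cardsT.
have dom t : exists2 i, i \in [set i | inr i \notin Z] &
    forall c, c \in [set t | inl t \in Z] -> r i t <= r i c.
  have [i Hi] := dominantP _ _ dZ (inl t).
  exists i => [|c]; first by rewrite inE (not_below _ _ _ Hi).
  by rewrite inE => /Hi.
exists [set t | inl t \in Z], [set i | inr i \notin Z]; split=> //.
  by have [i iD _] := dom t0; apply/set0Pn; exists i.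
apply/setP => i; rewrite inE; apply/imsetP/idP => [[t]|iZ].
  by rewrite inE => tZ ->; apply/negP => lZt; have := lab_inj _ _ tZ lZt erefl.
have : i \in slack_label @: Z by rewrite lZ inE.
case/imsetP=> -[t|j] wZ /= ij; first by exists t; rewrite ?inE.
by rewrite ij wZ in iZ.
Qed.

End Scarf.

(** * Small cells in the barycentric grid of a simplex *)

(** Barycentric coordinates are scaled by [N] to stay integral; bounding each by [N] makes the type
    finite. *)
Definition grid (I : finType) (N : nat) : finType :=
  {t : {ffun I -> 'I_N.+1} | \sum_i t i == N :> nat}.

Definition gcoord (I : finType) N (t : grid I N) (i : I) : nat := val t i.

Lemma sum_gcoord (I : finType) N (t : grid I N) : \sum_i gcoord t i = N.
Proof. exact/eqP/(valP t). Qed.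

Lemma grid_exists (I : finType) N (f : I -> nat) :
  \sum_i f i = N -> exists t : grid I N, forall i, gcoord t i = f i.
Proof.
move=> fN; have lt i : f i < N.+1 by rewrite ltnS -fN (bigD1 i) ?leq_addr.
pose t := [ffun i => Ordinal (lt i)].
have sumt : \sum_i t i == N :> nat.
  by apply/eqP; rewrite -[RHS]fN; apply: eq_bigr => i _; rewrite ffunE.
by exists (Sub t sumt) => i; rewrite /gcoord SubK ffunE.
Qed.

(** Scarf's lemma is applied to the coordinate orders. The last clause stands in for the boundary
    condition of Sperner's lemma, since [l] is arbitrary. *)
Lemma small_labelled_cell (I : finType) (i0 : I) (N : nat) (l : grid I N -> I) :
  exists C : {set grid I N}, [/\ C != set0,
    forall c c' i, c \in C -> c' \in C -> gcoord c i <= gcoord c' i + #|I| &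
    forall c i, c \in C -> i \notin l @: C -> gcoord c i <= #|I|].
Proof.
(* Ties between equal coordinates are broken by the enumeration; Euclidean division recovers the
   coordinate. *)
pose r i (t : grid I N) := gcoord t i * #|grid I N| + enum_rank t.
have rK i t : r i t %/ #|grid I N| = gcoord t i.
  rewrite /r divnMDl ?divn_small ?addn0 //.
  by apply/card_gt0P; exists t.
have r_inj i : injective (r i).
  move=> s t e; have := e; rewrite /r -(rK i s) -(rK i t) e => /addnI/ord_inj.
  exact: enum_rank_inj.
have [t0 _] : exists t0 : grid I N, forall i, gcoord t0 i = if i == i0 then N else 0.
  by apply: grid_exists; rewrite -big_mkcond big_pred1_eq.
have [C [D [Dn0 lC dom]]] := scarf l r_inj t0.
have {}dom (t : grid I N) : exists2 i, i \in D & forall c, c \in C -> gcoord t i <= gcoord c i.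
  have [i iD Hi] := dom t; exists i => // c /Hi.
  by rewrite -(rK i t) -(rK i c); apply: leq_div2r.
have /set0Pn[d dD] := Dn0.
have Cn0 : C != set0 by apply: contra_neq Dn0 => C0; rewrite -lC C0 imset0.
have [c0 c0C] := set0Pn _ Cn0.
(* The value 0 outside [D] turns the bound [near] into the smallness of the coordinates whose label
   is absent. *)
pose m i := if i \in D then gcoord [arg min_(c < c0 in C) gcoord c i] i else 0.
have mle (c : grid I N) i : c \in C -> m i <= gcoord c i.
  by rewrite /m; case: ifP => // _; case: arg_minnP => // ? _; apply.
have mex i : i \in D -> exists2 c, c \in C & m i = gcoord c i.
  by rewrite /m => ->; case: arg_minnP => // c cC _; exists c.
pose m1 i := m i + (i \in D).
(* Otherwise, after placing the missing mass on [d], a grid point would exceed the minimum over [C]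
   in every coordinate of [D], against [dom]. *)
have sum_m1 : N < \sum_i m1 i.
  rewrite ltnNge; apply/negP => le_N.
  have [t Ht] : exists t : grid I N, forall i, gcoord t i =
      m1 i + (if i == d then N - \sum_i m1 i else 0).
    by apply: grid_exists; rewrite big_split /= -big_mkcond big_pred1_eq subnKC.
  have [i iD Hi] := dom t; have [c cC mc] := mex i iD.
  by have := Hi c cC; rewrite Ht /m1 iD -mc addn1 addSn leqNgt ltnS leq_addr.
have {}sum_m1 : N <= \sum_i m i + #|I|.
  apply: leq_trans (ltnW sum_m1) _; rewrite big_split leq_add2l.
  by rewrite -sum1_card; apply: leq_sum => i _; apply: leq_b1.
have near (c : grid I N) i : c \in C -> gcoord c i <= m i + #|I|.
  move=> cC; move: sum_m1; rewrite -{1}(sum_gcoord c) (bigD1 i) //=.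
  rewrite [in X in _ <= X](bigD1 i) //= addnAC => H.
  rewrite -(leq_add2r (\sum_(k | k != i) gcoord c k)) (leq_trans H) //.
  by rewrite leq_add2l; apply: leq_sum => k _; apply: mle.
exists C; split=> // [c c' i cC c'C|c i cC].
  by rewrite (leq_trans (near _ _ cC)) // leq_add2r mle.
by rewrite lC => iD; have := near c i cC; rewrite /m (negPf iD).
Qed.

Require Import Defs.
From mathcomp Require Import all_boot all_order all_algebra finmap.
From mathcomp Require Import all_classical all_reals all_analysis.
From mathcomp Require Import ring lra.

Import Order.TTheory GRing.Theory Num.Theory.
Import numFieldNormedType.Exports.

Local Open Scope classical_set_scope.
Local Open Scope ring_scope.

(** * Variational inequalities on compact convex sets *)

Lemma convex_set_sum (R : realType) (V : lmodType R) (S : set V) :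
  convex_set S -> forall (I : finType) (w : I -> R) (y : I -> V),
  (forall i, 0 <= w i) -> \sum_i w i = 1 -> (forall i, S (y i)) ->
  S (\sum_i w i *: y i).
Proof.
move=> cS I w y w0 w1 Sy.
have conv2 (t : R) a b : 0 <= t <= 1 -> S a -> S b -> S (t *: a + (1 - t) *: b).
  move=> /andP[t0 t1] Sa Sb.
  have /(_ (Itv01 t0 t1)) := cS a b.
  by rewrite !inE; apply.
have w_ge0 s : 0 <= \sum_(i <- s) w i by apply: sumr_ge0.
(* Partial sums are normalised so that induction on the list uses one two-point combination per
   step; a tail of zero mass is treated apart. *)
suff /(_ (index_enum I)) : forall s, 0 < \sum_(i <- s) w i ->
    S ((\sum_(i <- s) w i)^-1 *: \sum_(i <- s) w i *: y i).
  by rewrite w1 invr1 scale1r ltr01; apply.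
elim=> [|i s IH]; first by rewrite big_nil ltxx.
rewrite !big_cons; set W := \sum_(j <- s) w j in IH *.
set v := \sum_(j <- s) _ in IH *.
move=> iW; have iW0 : w i + W != 0 by rewrite gt_eqF.
have [W0|W0] := eqVneq W 0.
  have -> : v = 0.
    rewrite /v big1_seq // => j /= js; apply/eqP; rewrite scaler_eq0; apply/orP; left.
    have /allP/(_ j js) : all (fun j => true ==> (w j == 0)) s.
      by rewrite -psumr_eq0 // -/W W0.
    by [].
  rewrite W0 !addr0 scalerA mulVf ?scale1r //.
  by rewrite W0 addr0 in iW0.
have Wgt : 0 < W by rewrite lt_def W0 /W w_ge0.
have t01 : 0 <= w i / (w i + W) <= 1.
  rewrite divr_ge0 ?(ltW iW) //= ler_pdivrMr // mul1r lerDl ltW //.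
have := conv2 _ _ _ t01 (Sy i) (IH Wgt).
rewrite scalerA scalerDr scalerA [_^-1 * _]mulrC; congr S.
congr (_ + _ *: _); field.
by rewrite iW0 W0.
Qed.

(** Half of a continuity radius at [x] works for all points near [x]; the near-covering form of
    compactness makes this uniform over [S]. *)
Lemma compact_unif_continuous (R : realType) (V : normedModType R) (S : set V)
    (f : V -> R) : compact S -> continuous f -> forall e : R, 0 < e ->
  \forall d \near 0^'+, forall x x', S x -> `|x - x'| < d -> `|f x - f x'| < e.
Proof.
move=> cS cf e e0.
have e2 : 0 < e / 2 by rewrite divr_gt0.
pose P (d : R) x := forall x', `|x - x'| < d -> `|f x - f x'| < e.
have H : \forall d \near 0^'+, S `<=` P d.
  move/compact_near_coveringP: cS; apply => x Sx.
  have /cvgrPdist_lt/(_ _ e2)/nbhs_ballP[d /= d0 Hd] := cf x.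
  have d2 : 0 < d / 2 by rewrite divr_gt0.
  near=> y d' => /= x' yx'.
  have : ball x (d / 2) y by near: y; apply: nbhsx_ballx.
  rewrite -ball_normE /= => xy.
  have d'd : d' < d / 2 by near: d'; apply: nbhs_right_lt.
  have fy : `|f x - f y| < e / 2.
    by apply: Hd; rewrite -ball_normE /=; apply: lt_trans xy _; lra.
  have fx' : `|f x - f x'| < e / 2.
    apply: Hd; rewrite -ball_normE /=.
    by have := ler_distD y x x'; lra.
  by have := ler_distD (f x) (f y) (f x'); rewrite (distrC (f y) (f x)); lra.
by apply: filterS H => d Hd x x' Sx; apply: Hd.
Unshelve. all: by end_near. Qed.

Lemma approx_variational (R : realType) (V : normedModType R) (S : set V)
    (I : finType) (i0 : I) (y : I -> V) (h : I -> V -> R) :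
  compact S ->
  (forall w : I -> R, (forall i, 0 <= w i) -> \sum_i w i = 1 ->
     S (\sum_i w i *: y i)) ->
  (forall i, continuous (h i)) ->
  (forall w : I -> R, (forall i, 0 <= w i) -> \sum_i w i = 1 ->
     0 <= \sum_i w i * h i (\sum_j w j *: y j)) ->
  forall e : R, 0 < e -> exists2 x, S x & forall i, - e <= h i x.
Proof.
move=> cS hullS ch h0 e e0.
have e4 : 0 < e / 4 by rewrite divr_gt0.
have [d [d0 Hd]] : exists d : R, 0 < d /\ forall i x x', S x -> `|x - x'| < d ->
    `|h i x - h i x'| < e / 4.
  have H : \forall d \near 0^'+, forall i x x', S x -> `|x - x'| < d ->
      `|h i x - h i x'| < e / 4.
    by apply: filter_forall => i; apply: compact_unif_continuous.
  have [d [Hd d0]] := filter_ex (filterI H (nbhs_right_gt 0)).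
  by exists d.
have [M [M0 HM]] : exists M : R, 0 < M /\ forall i x, S x -> `|h i x| <= M.
  have H : \forall M \near +oo, forall i x, S x -> `|h i x| <= M.
    apply: filter_forall => i.
    have /compact_bounded[M [Mreal HM]] :=
      continuous_compact (continuous_subspaceT (ch i)) cS.
    apply: filterS (nbhs_pinfty_gt Mreal) => M' MM' x Sx.
    by apply: HM MM' _ _; exists x.
  have [M M0 HM] := pinfty_ex_gt0 H.
  by exists M.
pose k : R := #|I|%:R.
have k0 : 0 <= k by rewrite ler0n.
pose Y := \sum_i `|y i|.
have Y0 : 0 <= Y by apply: sumr_ge0.
(* The first bound makes the cell smaller than [d]; the second keeps the total contribution of the
   labels absent from the cell below [e / 2]. *)
have [N [N1 N2]] : exists N : nat, k * Y < d * N.+1%:R /\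
    k * k * (2 * M) < e / 2 * N.+1%:R.
  have kY : 0 <= k * Y / d by rewrite divr_ge0 ?mulr_ge0 // ltW.
  have kM : 0 <= k * k * (2 * M) / (e / 2).
    by rewrite divr_ge0 ?mulr_ge0 ?divr_ge0 // ltW.
  exists (Num.bound (k * Y / d) + Num.bound (k * k * (2 * M) / (e / 2)))%N.
  rewrite -addn1 !natrD; have := archi_boundP kY; have := archi_boundP kM.
  set a := (Num.bound _)%:R; set b := (Num.bound _)%:R => H1 H2.
  have a0 : 0 <= a by rewrite ler0n.
  have b0 : 0 <= b by rewrite ler0n.
  by split; rewrite [ltRHS]mulrC -ltr_pdivrMr ?divr_gt0 //; lra.
pose n : R := N.+1%:R.
have n0 : 0 < n by rewrite ltr0n.
have nV0 : 0 <= n^-1 by rewrite invr_ge0 ltW.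
pose w (t : grid I N.+1) i : R := (gcoord t i)%:R / n.
have w_ge0 t i : 0 <= w t i by rewrite divr_ge0 // ltW.
have w_sum t : \sum_i w t i = 1.
  by rewrite -mulr_suml -natr_sum sum_gcoord divff // gt_eqF.
pose x t := \sum_i w t i *: y i.
have Sx t : S (x t) by apply: hullS.
pose l t := [arg min_(i < i0) h i (x t)]%O.
have lP t i : h (l t) (x t) <= h i (x t).
  by rewrite /l; case: arg_minP => // j _; apply.
have [C [/set0Pn[c cC] nearC offC]] := small_labelled_cell i0 l.
have w_near t t' i : t \in C -> t' \in C -> `|w t i - w t' i| <= k / n.
  move=> tC t'C; rewrite -mulrBl normrM (ger0_norm nV0).
  rewrite ler_pM2r ?invr_gt0 // ler_norml.
  have := nearC _ _ i tC t'C; have := nearC _ _ i t'C tC.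
  rewrite -!(ler_nat R) !natrD -/k => H1 H2.
  by apply/andP; split; lra.
have x_near t t' : t \in C -> t' \in C -> `|x t - x t'| < d.
  move=> tC t'C; apply: le_lt_trans (_ : k / n * Y < d); last first.
    by rewrite mulrAC ltr_pdivrMr.
  rewrite /x -sumrB (le_trans (ler_norm_sum _ _ _)) // mulr_sumr.
  by apply: ler_sum => i _; rewrite -scalerBl normrZ ler_wpM2r // w_near.
have hx_near t t' i : t \in C -> t' \in C -> `|h i (x t) - h i (x t')| < e / 4.
  by move=> tC t'C; apply: Hd => //; apply: x_near.
exists (x c) => // j.
(* If [i] labels some [t] in [C], moving from [x c] to [x t] and back costs [e / 4] each way, and
   [h i] is minimal at [x t]. If not, the weight [w c i] is at most [k / n]. *)
have term i : w c i * (h i (x c) - h j (x c)) <= w c i * (e / 2) + k / n * (2 * M).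
  have pos1 : 0 <= w c i * (e / 2) by rewrite mulr_ge0 // ltW // divr_gt0.
  have kn0 : 0 <= k / n by rewrite divr_ge0 // ltW.
  have pos2 : 0 <= k / n * (2 * M) by rewrite !mulr_ge0 // ltW.
  case: (boolP (i \in l @: C)) => [/imsetP[t tC it]|iC].
    rewrite ler_wpDr // ler_wpM2l //.
    have := hx_near c t i cC tC; have := hx_near c t j cC tC; have := lP t j.
    by rewrite -it !ltr_norml => H /andP[? ?] /andP[? ?]; lra.
  rewrite ler_wpDl //; apply: (@le_trans _ _ (w c i * (2 * M))).
    rewrite ler_wpM2l //; have := HM i _ (Sx c); have := HM j _ (Sx c).
    by rewrite !ler_norml => /andP[? ?] /andP[? ?]; lra.
  rewrite ler_wpM2r ?mulr_ge0 ?(ltW M0) // ler_wpM2r //.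
  by rewrite ler_nat offC.
have : - h j (x c) <= e / 2 + k * (k / n * (2 * M)).
  have : \sum_i w c i * (h i (x c) - h j (x c)) <=
      \sum_i (w c i * (e / 2) + k / n * (2 * M)) by apply: ler_sum.
  under eq_bigr do rewrite mulrBr.
  rewrite sumrB -mulr_suml w_sum mul1r big_split /= -mulr_suml w_sum mul1r.
  rewrite sumr_const (_ : #|xpredT| = #|I|) // -[k / n * _ *+ _]mulr_natl -/k.
  by apply: le_trans; rewrite -[leLHS]add0r lerD2r; apply: h0.
have : k * (k / n * (2 * M)) < e / 2.
  have -> : k * (k / n * (2 * M)) = k * k * (2 * M) / n by ring.
  by rewrite ltr_pdivrMr.
set A := k * _ => HA hA; rewrite lerNl (le_trans hA) // [leRHS]splitr lerD2l ltW //.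
Qed.

(** Each pair of a test point and a tolerance defines a closed subset of the compact [S], so the
    finite intersection property reduces the claim to [approx_variational]. *)
Lemma variational_inequality (R : realType) (V : normedModType R) (S : set V)
    (g : V -> V -> R) :
  S !=set0 -> compact S -> convex_set S ->
  (forall y, continuous (g ^~ y)) ->
  (forall x (I : finType) (w : I -> R) (y : I -> V),
     g x (\sum_i w i *: y i) = \sum_i w i * g x (y i)) ->
  (forall x, S x -> 0 <= g x x) ->
  exists2 x, S x & forall y, S y -> 0 <= g x y.
Proof.
move=> [s0 Ss0] cS convS cg lin_g g0.
pose f (p : V * R) := S `&` [set x | - p.2 <= g x p.1].
have [] : \bigcap_(p in [set p : V * R | S p.1 /\ 0 < p.2]) f p !=set0.
  have := cS; rewrite {1}compact_In0; apply.
    exists (fun p : V * R => [set x | - p.2 <= g x p.1]) => // p _.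
    apply: (@closed_comp _ _ (g ^~ p.1) [set r | - p.2 <= r]).
      by move=> x _; apply: cg.
    exact: closed_ge.
  move=> D' sD'.
  have D'P (p : D') : S (fsval p).1 /\ 0 < (fsval p).2.
    by have := sD' _ (fsvalP p); rewrite inE.
  (* The least tolerance serves all test points at once; the default 1 keeps it positive. *)
  pose e : R := \big[Num.min/1]_(p : D') (fsval p).2.
  have e0 : 0 < e by apply: lt_bigmin => // p _; case: (D'P p).
  have [p0|noD'] := pickP (@predT D'); last first.
    by exists s0 => p pD'; have := noD' [` pD']%fset.
  have [x Sx Hx] : exists2 x, S x & forall p : D', - e <= g x (fsval p).1.
    apply: (approx_variational p0 (y := fun p : D' => (fsval p).1)
      (h := fun p x => g x (fsval p).1)) => //.
      by move=> w w0 w1; apply: (convex_set_sum convS w0 w1) => p; case: (D'P p).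
    move=> w w0 w1; rewrite -lin_g; apply: g0.
    by apply: convex_set_sum => // p; case: (D'P p).
  exists x => p pD'; split=> //=; apply: le_trans (Hx [` pD']%fset).
  by rewrite lerN2; apply: (bigmin_le _ [` pD']%fset).
move=> x xf; have Sx : S x by case: (xf (s0, 1)) => //=; split.
exists x => // y Sy; rewrite -oppr_le0; apply/ler_addgt0Pr => e e0.
by have [_ /=] := xf (y, e) (conj Sy e0); lra.
Qed.

(** * Contraction identity and continuity for tensor forms *)

(** A multi-index splits into head and tail, and the inner product supplies the factor of the
    head. *)
Lemma dotv_tapply (R : realType) (m n : nat) (A : tensor R m.+1 n)
  (x : 'rV[R]_n) : dotv x (tapply A x) = tform A x.
Proof.
rewrite /dotv /tform (reindex (fun p : 'I_n * m.-tuple 'I_n => [tuple of p.1 :: p.2])) /=.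
  rewrite -(pair_bigA _ (fun i (j : m.-tuple 'I_n) => A [tuple of i :: j] *
    \prod_(k < m.+1) x 0 (tnth [tuple of i :: j] k))) /=.
  apply: eq_bigr => i _; rewrite mxE mulr_sumr; apply: eq_bigr => j _.
  rewrite big_ord_recl tnth0 mulrCA; congr (_ * (_ * _)).
  by apply: eq_bigr => k _; rewrite tnthS.
exists (fun t : m.+1.-tuple 'I_n => (thead t, [tuple of behead t])).
  by move=> [i j] _ /=; rewrite theadE; congr pair; apply: val_inj.
by move=> t _ /=; rewrite [RHS]tuple_eta.
Qed.

Lemma dotvC (R : realType) n (x y : 'rV[R]_n) : dotv x y = dotv y x.
Proof. by apply: eq_bigr => i _; rewrite mulrC. Qed.

Lemma dotv_sumr (R : realType) n (x : 'rV[R]_n) (I : finType) (w : I -> R)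
    (y : I -> 'rV[R]_n) :
  dotv x (\sum_i w i *: y i) = \sum_i w i * dotv x (y i).
Proof.
rewrite /dotv; under [RHS]eq_bigr do rewrite mulr_sumr.
rewrite exchange_big; apply: eq_bigr => k _.
rewrite summxE mulr_sumr; apply: eq_bigr => i _; rewrite mxE; ring.
Qed.

Lemma dotvZr (R : realType) n (x y : 'rV[R]_n) a : dotv x (a *: y) = a * dotv x y.
Proof. by rewrite /dotv mulr_sumr; apply: eq_bigr => i _; rewrite mxE; ring. Qed.

Lemma dotvBr (R : realType) n (x y z : 'rV[R]_n) :
  dotv x (y - z) = dotv x y - dotv x z.
Proof. by rewrite /dotv -sumrB; apply: eq_bigr => i _; rewrite !mxE; ring. Qed.

Lemma continuous_mul (R : realType) (T : topologicalType) (f g : T -> R) :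
  continuous f -> continuous g -> continuous (fun x => f x * g x).
Proof. by move=> cf cg x; apply: cvgM; [exact: cf | exact: cg]. Qed.

Lemma continuous_sub (R : realType) (T : topologicalType) (f g : T -> R) :
  continuous f -> continuous g -> continuous (fun x => f x - g x).
Proof. by move=> cf cg x; apply: cvgB; [exact: cf | exact: cg]. Qed.

Lemma continuous_sum (R : realType) (T : topologicalType) (I : finType)
    (f : I -> T -> R) :
  (forall i, continuous (f i)) -> continuous (fun x => \sum_i f i x).
Proof.
by move=> cf; apply: continuous_big => // ; apply: add_continuous.
Qed.

Lemma continuous_monomial (R : realType) m n (j : m.-tuple 'I_n) :
  continuous (fun x : 'rV[R]_n => \prod_(k < m) x 0 (tnth j k)).
Proof.
apply: continuous_big => [|k _]; first exact: mul_continuous.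
exact: coord_continuous.
Qed.

Lemma continuous_tform (R : realType) m n (A : tensor R m n) :
  continuous (fun x : 'rV[R]_n => tform A x).
Proof.
apply: continuous_sum => j; apply: continuous_mul ; first exact: cst_continuous.
exact: continuous_monomial.
Qed.

Lemma continuous_dotv_tapply (R : realType) m n (A : tensor R m.+1 n)
    (y : 'rV[R]_n) : continuous (fun x : 'rV[R]_n => dotv (tapply A x) y).
Proof.
apply: continuous_sum => i; apply: continuous_mul ; last exact: cst_continuous.
under eq_fun do rewrite mxE.
apply: continuous_sum => j; apply: continuous_mul ; first exact: cst_continuous.
exact: continuous_monomial.
Qed.

Theorem theorem2p1 (R : realType) (m n : nat)
    (A B : tensor R m.+1 n.+1) (K S : set 'rV[R]_n.+1)
    (Kclosed : closed K) (Kconvex : convex_set K) (Kcone : is_cone K)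
    (Kpointed : K `&` [set - x | x in K] = [set 0])
    (SbasisK : is_cone_basis S K)
    (Sconvex : convex_set S) (Scompact : compact S)
    (Bneq0 : forall x, S x -> tform B x != 0) :
  exists (lambda : R) (x : 'rV[R]_n.+1),
    x != 0 /\
    [/\ K x,
        pos_dual K (lambda *: tapply B x - tapply A x) &
        dotv x (lambda *: tapply B x - tapply A x) = 0].
Proof.
have [S0 KE nS0 _] := SbasisK.
pose a x := tform A x; pose b x := tform B x.
(* Without division, [g] is continuous in [x] on the whole space, even where [b] vanishes outside
   [S]. *)
pose g (x y : 'rV[R]_n.+1) :=
  b x * (a x * dotv (tapply B x) y - b x * dotv (tapply A x) y).
have [x Sx Hx] : exists2 x, S x & forall y, S y -> 0 <= g x y.
  apply: variational_inequality => //.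
  - move=> y; apply: continuous_mul; first exact: continuous_tform.
    apply: continuous_sub; apply: continuous_mul;
      by [exact: continuous_tform | exact: continuous_dotv_tapply].
  - move=> x I w y; rewrite /g !dotv_sumr !mulr_sumr -sumrB mulr_sumr.
    by apply: eq_bigr => i _; ring.
  - move=> x _; rewrite /g !(dotvC _ x) !dotv_tapply -/(a x) -/(b x).
    by rewrite [a x * _]mulrC subrr mulr0.
have bx0 : b x != 0 by apply: Bneq0.
exists (a x / b x), x; split; first by apply: contra_notN nS0 => /eqP <-.
split.
- by rewrite KE; exists x, 1; rewrite scale1r.
- move=> k; rewrite KE => -[s [t [Ss t0 ->]]].
  rewrite dotvZr mulr_ge0 // dotvC dotvBr dotvZr ![dotv s _]dotvC.
  (* The denominator is a square, so the sign of [b x] does not matter. *)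
  have -> : a x / b x * dotv (tapply B x) s - dotv (tapply A x) s =
      g x s / b x ^+ 2 by rewrite /g; field.
  by rewrite divr_ge0 ?sqr_ge0 ?Hx.
- rewrite dotvBr dotvZr !dotv_tapply -/(a x) -/(b x).
  by rewrite divfK // subrr.
Qed.
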